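(* Let $I \subset S=K[x_1,\dots,x_n]$ be a monomial ideal of Borel type with irredundant irreducible decomposition $I = \bigcap_{i=1}^r Q_i$, and let $P \in \mathrm{Ass}(I)$. Then $P$ is of the form $P = \langle x_1,\dots,x_k \rangle$. Let $Q = \langle x_1^{a_1},\dots,x_k^{a_k} \rangle$ be a $P$-primary component of $I$ in the irredundant irreducible decomposition of $I$ (that is, $Q$ is one of the $Q_i$ and $\sqrt{Q}=P$). If $k < n$, then $P = (I : v)$, where $$v= x_1^{a_1 - 1} x_2^{a_2 - 1} \cdots x_k^{a_k - 1} x_{k+1}^{b_{k+1}}$$ and $b_{k+1}$ is any integer with $b_{k+1} \geq \max\{\nu_{k+1}(u) \mid u \in G(I)\}$.
   Context: $K$ is a field and $S = K[x_1,\dots,x_n]$. A monomial ideal $I\subset S$ is of Borel type if $I : x_i^{\infty} = I : \langle x_1,\dots,x_i \rangle^{\infty}$ for $i = 1,\dots, n$, where $I:J^\infty=\bigcup_{m\ge 0}(I:J^m)$. $G(I)$ denotes the unique minimal set of monomial generators of $I$. For a monomial $u$, $\nu_i(u)$ is the exponent of $x_i$ in $u$ (equal to $0$ if $x_i$ does not divide $u$). $\mathrm{Ass}(I)$ is the set of associated primes of $S/I$. The irredundant irreducible decomposition of a monomial ideal $I$ is the unique presentation $I=\bigcap_{i=1}^r Q_i$ in which each $Q_i$ is generated by pure powers of variables (i.e. $Q_i=\langle x_{j_1}^{c_1},\dots,x_{j_m}^{c_m}\rangle$ with distinct $j_1,\dots,j_m$ and all $c_l\ge 1$) and none of the $Q_i$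 can be omitted. Such an ideal is $\langle x_{j_1},\dots,x_{j_m}\rangle$-primary. The colon ideal is $(I:v)=\{f\in S : fv\in I\}$. *)

(* Defs.v *)
From mathcomp Require Import all_boot all_order all_algebra finmap.
From mathcomp Require Import mpoly.
From mathcomp Require Import classical_sets.

Set Implicit Arguments.
Unset Strict Implicit.
Unset Printing Implicit Defensive.

Import GRing.Theory.
Local Open Scope classical_set_scope.
Local Open Scope ring_scope.

(* The variable written x_(i+1) on paper is 'X_i with i : 'I_n.  Ideals are
   classical sets satisfying is_ideal; the library's idealr structure is not
   used because it excludes the unit ideal, which colon ideals may produce. *)

Definition is_ideal (R : comNzRingType) (I : set R) : Prop :=
  I 0 /\ forall a f g, I f -> I g -> I (a * f + g).

Definition ideal_gen (R : comNzRingType) (A : set R) : set R :=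
  smallest (@is_ideal R) A.

Definition ideal_mul (R : comNzRingType) (I J : set R) : set R :=
  ideal_gen [set f * g | f in I & g in J].

Fixpoint ideal_exp (R : comNzRingType) (J : set R) (m : nat) : set R :=
  if m is m'.+1 then ideal_mul J (ideal_exp J m') else setT.

Definition colon_ideal (R : comNzRingType) (I J : set R) : set R :=
  [set f | forall g, J g -> I (f * g)].

Definition colon (R : comNzRingType) (I : set R) (v : R) : set R :=
  [set f | I (f * v)].

Definition saturation (R : comNzRingType) (I J : set R) : set R :=
  \bigcup_(m in [set: nat]) colon_ideal I (ideal_exp J m).

Definition radical (R : comNzRingType) (I : set R) : set R :=
  [set f | exists m : nat, I (f ^+ m)].

Definition prime_ideal (R : comNzRingType) (P : set R) : Prop :=
  [/\ is_ideal P, ~ P 1 & forall f g, P (f * g) -> P f \/ P g].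

(* (I : f) is the annihilator of the class of f in R / I. *)
Definition associated_prime (R : comNzRingType) (I P : set R) : Prop :=
  prime_ideal P /\ exists f : R, P = colon I f.

Section Monomial.
Variables (K : fieldType) (n : nat).
Implicit Types (I : set {mpoly K[n]}) (D : set 'I_n).

Definition monomial_gen (A : set 'X_{1..n}) : set {mpoly K[n]} :=
  ideal_gen [set 'X_[K, u] | u in A].

Definition monomial_ideal I : Prop :=
  exists A : set 'X_{1..n}, I = monomial_gen A.

(* Monomials are identified with their exponent vectors; a finite set G with
   this property exists by Dickson's lemma, and it is unique. *)
Definition min_monomial_gens I (G : {fset 'X_{1..n}}) : Prop :=
  I = monomial_gen [set` G] /\
  forall G' : {fset 'X_{1..n}}, (G' `<` G)%fset -> I <> monomial_gen [set` G'].

Definition first_vars (k : nat) : set 'I_n := [set i : 'I_n | (i < k)%N].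

Definition var_ideal D : set {mpoly K[n]} := ideal_gen [set 'X_i | i in D].

Definition pure_power_gen D (c : 'I_n -> nat) : set {mpoly K[n]} :=
  ideal_gen [set 'X_i ^+ c i | i in D].

(* D may be empty, since the zero ideal is irreducible. *)
Definition pure_power_ideal I : Prop :=
  exists D, exists c : 'I_n -> nat,
    (forall i, D i -> (0 < c i)%N) /\ I = pure_power_gen D c.

Definition borel_type I : Prop :=
  monomial_ideal I /\
  forall i : 'I_n,
    saturation I (var_ideal [set i]) =
    saturation I (var_ideal (first_vars i.+1)).

Definition irredundant_irreducible_decomposition I (r : nat)
    (Q : 'I_r -> set {mpoly K[n]}) : Prop :=
  [/\ forall j, pure_power_ideal (Q j),
      I = \bigcap_(j in [set: 'I_r]) Q j &
      forall j0, I <> \bigcap_(j in [set~ j0]) Q j].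

End Monomial.

Arguments var_ideal {K n} D.
Arguments pure_power_gen {K n} D c.
Arguments first_vars {n} k.

(* Main.v *)
Require Import Defs.
From mathcomp Require Import all_boot all_order all_algebra finmap.
From mathcomp Require Import mpoly.
From mathcomp Require Import boolp classical_sets.

Local Open Scope classical_set_scope.
Local Open Scope ring_scope.

(** Write [Q j] as generated by the powers [c j i] of the variables [i] in
    [D j].  Everything rests on corner monomials.  By irredundancy some monomial
    lies in all components except [Q j]; raising its exponents to [c j i - 1] on
    [D j] keeps it outside [Q j] and inside the others ([corner_monomial]).
    This corner [w] is not in [I], while [w * x_i] is, for every [i] in [D j]
    ([corner_socle]).  Three facts follow.

    - If [I] is of Borel type, [D j] is an initial segment of the variables
      ([borel_component_down_closed]): [w] is in the saturation of [I] by [x_i],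
      hence in the one by [x_1, ..., x_i], so a power of [x_p] with [p <= i]
      moves [w] into [Q j], which is impossible when [p] is outside [D j].
    - The exponent [c j i] occurs in a generator of [I]
      ([component_exponent_in_gens]).
    - The corner of [Q j] lies in every other component [Q j'], so one of the
      generators of [Q j'] divides it.

    An associated prime contains the colon of some component, and this forces
    it to be generated by the variables of [D j] for that component
    ([associated_prime_component]); so it is generated by the first [k]
    variables.

    For the colon formula, [v] agrees with the corner of [Q j] on the first [k]
    variables.  Given another component, some generator [x_t ^ c] of it divides
    that corner.  If [t] is among the first [k] variables, [x_t ^ c] divides
    [v].  Otherwise the component involves the next variable as well, to an
    exponent occurring in a generator of [I] and hence at most [b].  Either way
    [v] lies in every component but [Q j], so the colon of [I] by [v] is that
    of [Q j] by [v], which is generated by the first [k] variables. *)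

(** * Ideals of a commutative ring *)

Section Ideals.
Set Implicit Arguments.
Unset Strict Implicit.
Import GRing.Theory.
Variable R : comNzRingType.
Implicit Types (I J A : set R) (f g : R).

Lemma idealD I f g : is_ideal I -> I f -> I g -> I (f + g).
Proof. by case=> _ IH If Ig; rewrite -[f]mul1r; apply: IH. Qed.

Lemma idealM I f g : is_ideal I -> I g -> I (f * g).
Proof. by case=> I0 IH Ig; rewrite -[_ * _]addr0; apply: IH. Qed.

Lemma idealB I f g : is_ideal I -> I f -> I g -> I (f - g).
Proof. by move=> [I0 IH] If Ig; rewrite addrC -mulN1r; apply: IH. Qed.

Lemma ideal_sum (T : eqType) I (s : seq T) (F : T -> R) : is_ideal I ->
  (forall x, x \in s -> I (F x)) -> I (\sum_(x <- s) F x).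
Proof.
move=> idI IF; rewrite big_seq; apply: (big_ind I) => //; first by case: idI.
by move=> f g; apply: idealD.
Qed.

Lemma ideal_gen_ideal A : is_ideal (ideal_gen A).
Proof.
split=> [J [[]] //|a f g genf geng J JA].
by case: (JA) => -[_ IH] _; apply: IH; [exact: genf|exact: geng].
Qed.

Lemma mem_ideal_gen A f : A f -> ideal_gen A f.
Proof. by move=> Af J [_]; apply. Qed.

Lemma ideal_gen_min A I : is_ideal I -> A `<=` I -> ideal_gen A `<=` I.
Proof. exact: smallest_sub. Qed.

Lemma colon_is_ideal I f : is_ideal I -> is_ideal (colon I f).
Proof.
move=> [I0 IH]; split; first by rewrite /colon /= mul0r.
by move=> a g h; rewrite /colon /= mulrDl -mulrA; apply: IH.
Qed.

Lemma mem_ideal_exp J f m : J f -> ideal_exp J m (f ^+ m).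
Proof.
move=> Jf; elim: m => //= m IHm; apply: mem_ideal_gen; exists f => //.
by exists (f ^+ m) => //; rewrite exprS.
Qed.

Lemma prime_idealX P f m : prime_ideal P -> P (f ^+ m) -> P f.
Proof.
move=> [_ P1 Pmul]; elim: m => [|m IHm]; first by rewrite expr0.
by rewrite exprS => /Pmul[].
Qed.

(** A product of elements picked in each ideal lies in all of them, so a prime
    containing a finite intersection of ideals contains one of them. *)
Lemma prime_contains_component P (T : finType) (J : T -> set R) :
  prime_ideal P -> (forall j, is_ideal (J j)) ->
  \bigcap_(j in [set: T]) J j `<=` P -> exists j, J j `<=` P.
Proof.
move=> [_ P1 Pmul] idJ capP; apply: contrapT => noJ.
have /choice[g gP] : forall j, exists f, J j f /\ ~ P f.
  move=> j; apply: contrapT => nof; apply: noJ; exists j => f Jf.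
  by apply: contrapT => nPf; apply: nof; exists f.
have : P (\prod_j g j).
  apply: capP => j _; rewrite (bigD1 j) //= mulrC.
  by apply: idealM => //; case: (gP j).
apply: (big_ind (fun f => ~ P f)) => // [f h nf nh /Pmul[] //|j _].
by case: (gP j).
Qed.

End Ideals.

(** * Monomial ideals, tested on monomials *)

Section Monomials.
Set Implicit Arguments.
Unset Strict Implicit.
Import GRing.Theory.
Variables (K : fieldType) (n : nat).
Implicit Types (I P : set {mpoly K[n]}) (f g : {mpoly K[n]}).
Implicit Types (D : set 'I_n) (c : 'I_n -> nat) (m u v w : 'X_{1..n}).

Lemma monomial_genP (A : set 'X_{1..n}) f :
  monomial_gen A f <->
  forall m, m \in msupp f -> exists2 u, A u & (u <= m)%MM.
Proof.
split.
  apply: (ideal_gen_min (I := [set h : {mpoly K[n]} | forall m, m \in msupp h ->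
                                 exists2 u, A u & (u <= m)%MM])).
    split=> [m|a h1 h2 H1 H2 m]; first by rewrite msupp0.
    move=> /msuppD_le; rewrite mem_cat => /orP[/msuppM_le|/H2 //].
    move=> /allpairsP[[m1 m2] /= [_ /H1[u Au um2] ->]].
    exists u => //; apply/mnm_lepP => i; rewrite mnmDE.
    by apply: (leq_trans (mnm_lepP um2 i)); rewrite leq_addl.
  by move=> _ [u Au <-] /= m; rewrite msuppX inE => /eqP ->; exists u;
    rewrite ?lepm_refl.
move=> supA; have idA := ideal_gen_ideal [set 'X_[K, u] | u in A].
rewrite [f]mpolyE; apply: ideal_sum => // m /supA[u Au um].
rewrite -(submK um) mpolyXD scalerAl; apply: (idealM _ idA).
by apply: mem_ideal_gen; exists u.
Qed.

Lemma pure_power_genE D c :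
  pure_power_gen D c =
  monomial_gen [set (U_(i) *+ c i)%MM | i in D] :> set {mpoly K[n]}.
Proof.
rewrite /pure_power_gen /monomial_gen image_comp; congr ideal_gen.
by apply: eq_imagel => i _ /=; rewrite mpolyXn.
Qed.

Lemma mulmn1_le i k m : (U_(i) *+ k <= m)%MM = (k <= m i)%N.
Proof.
apply/mnm_lepP/idP => [/(_ i)|kmi j]; rewrite mulmnE mnm1E.
  by rewrite eqxx mul1n.
by case: eqP => [<-|_]; rewrite ?mul1n ?mul0n.
Qed.

Lemma pure_power_genP D c f :
  pure_power_gen D c f <->
  forall m, m \in msupp f -> exists2 i, D i & (c i <= m i)%N.
Proof.
rewrite pure_power_genE; apply: (iff_trans (monomial_genP _ _)).
split=> H m /H.
  by move=> [_ [i Di <-]]; rewrite mulmn1_le; exists i.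
move=> [i Di ci]; exists (U_(i) *+ c i)%MM; first by exists i.
by rewrite mulmn1_le.
Qed.

Lemma pure_power_genXP D c m :
  pure_power_gen D c 'X_[K, m] <-> exists2 i, D i & (c i <= m i)%N.
Proof.
apply: (iff_trans (pure_power_genP _ _ _)); split=> [|H m'].
  by apply; rewrite msuppX inE.
by rewrite msuppX inE => /eqP ->.
Qed.

(** Reduces every later question about [I] to exponent vectors. *)
Lemma monomial_idealP I f : monomial_ideal I ->
  I f <-> forall m, m \in msupp f -> I 'X_[K, m].
Proof.
case=> A ->; apply: (iff_trans (monomial_genP A f)).
split=> H m /H.
  by move=> ?; apply/monomial_genP => m'; rewrite msuppX inE => /eqP ->.
by move=> /monomial_genP; apply; rewrite msuppX inE.
Qed.

Lemma pure_power_gen_monomial D c :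
  monomial_ideal (pure_power_gen D c : set {mpoly K[n]}).
Proof. by rewrite pure_power_genE; exists [set (U_(i) *+ c i)%MM | i in D]. Qed.

Lemma monomial_ideal_ideal I : monomial_ideal I -> is_ideal I.
Proof. by case=> A ->; apply: ideal_gen_ideal. Qed.

Lemma monomial_ideal_le I m m' : monomial_ideal I ->
  (m <= m')%MM -> I 'X_[K, m] -> I 'X_[K, m'].
Proof.
move=> /monomial_ideal_ideal idI mm' Im.
by rewrite -(submK mm') mpolyXD; apply: idealM.
Qed.

Lemma colon_monomialP I v f : monomial_ideal I ->
  colon I 'X_[v] f <-> forall m, m \in msupp f -> I 'X_[K, v + m].
Proof.
move=> monI; apply: (iff_trans (monomial_idealP _ monI)).
have supE := perm_mem (msuppMX f v).
split=> H m.
  by move=> mf; apply: H; rewrite supE; apply/mapP; exists m.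
by rewrite supE => /mapP[m' /H ? ->].
Qed.

Lemma monomial_split (B : pred 'X_{1..n}) f : exists f1 f2,
  [/\ f = f1 + f2, forall m, m \in msupp f1 -> B m &
      forall m, m \in msupp f2 -> ~~ B m].
Proof.
have supp_sum (C : pred 'X_{1..n}) m :
    m \in msupp (\sum_(u <- msupp f | C u) f@_u *: 'X_[u]) -> C m.
  apply: (big_ind (fun h : {mpoly K[n]} => m \in msupp h -> C m)).
  - by rewrite msupp0.
  - by move=> g h Hg Hh /msuppD_le; rewrite mem_cat => /orP[/Hg|/Hh].
  - by move=> u Cu /msuppZ_le; rewrite msuppX inE => /eqP ->.
exists (\sum_(u <- msupp f | B u) f@_u *: 'X_[u]).
exists (\sum_(u <- msupp f | ~~ B u) f@_u *: 'X_[u]).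
split; [by rewrite {1}[f]mpolyE (bigID B)|exact: supp_sum|].
exact: (supp_sum (fun u => ~~ B u)).
Qed.

(** * Associated primes *)

(** Let [g * f] lie in the ideal [Q] of pure powers.  Discard from [f] its terms
    in [Q] and from [g] its terms divisible by a variable of [D].  The remaining
    factor of [g] involves only variables outside [D], so no monomial of the
    product of the two remainders can enter [Q]; as this product does lie in
    [Q], it vanishes, and polynomials over a field form a domain. *)
Lemma pure_power_colon_sub D c f :
  (forall i, D i -> (0 < c i)%N) -> ~ pure_power_gen D c f ->
  (var_ideal D `<=` colon (pure_power_gen D c) f) ->
  colon (pure_power_gen D c) f `<=` var_ideal D.
Proof.
set Q := pure_power_gen D c => cpos nQf varQ g Qgf.
have idQ : is_ideal Q by exact: ideal_gen_ideal.
have [f1 [f2 [fE Qf1 nQf2]]] := monomial_split (fun m => `[<Q 'X_[m]>]) f.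
have [g1 [g2 [gE Vg1 nVg2]]] :=
  monomial_split (fun m => `[<var_ideal D 'X_[K, m]>]) g.
have monQ : monomial_ideal Q by exact: pure_power_gen_monomial.
have monV : monomial_ideal (var_ideal D : set {mpoly K[n]}).
  exact: (pure_power_gen_monomial D (fun=> 1%N)).
have {}Qf1 : Q f1 by apply/(monomial_idealP _ monQ) => m /Qf1/asboolP.
have {}Vg1 : var_ideal D g1 by apply/(monomial_idealP _ monV) => m /Vg1/asboolP.
have Qg2f2 : Q (g2 * f2).
  have -> : g2 * f2 = g * f - g1 * f - g2 * f1.
    have -> : g2 = g - g1 by rewrite gE addrC addKr.
    have -> : f2 = f - f1 by rewrite fE addrC addKr.
    by rewrite mulrBr -mulrBl.
  apply: (idealB idQ); last exact: idealM idQ Qf1.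
  by apply: (idealB idQ Qgf); exact: varQ.
suff : g2 * f2 = 0.
  move=> /eqP; rewrite mulf_eq0 => /orP[/eqP g20|/eqP f20].
    by rewrite gE g20 addr0.
  by case: nQf; rewrite fE f20 addr0.
apply/eqP; rewrite -msupp_eq0; apply/negPn/negP => ne0.
have [m min] : exists m, m \in msupp (g2 * f2).
  by case: (msupp _) ne0 => // m s _; exists m; rewrite mem_head.
have /allpairsP[[m1 m2] /= [/nVg2 nV /nQf2 nQ mE]] := msuppM_le min.
have /pure_power_genXP[i Di] : Q 'X_[m].
  by exact: (monomial_idealP _ monQ).1 Qg2f2 _ min.
rewrite mE mnmDE; case: (posnP (m1 i)) => [-> ci|m1i _].
  by case/asboolP: nQ; apply/pure_power_genXP; exists i.
by case/asboolP: nV; apply/(pure_power_genXP D (fun=> 1%N)); exists i.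
Qed.

(** [P], the colon of [I] by some [f], is the intersection of the colons of the
    [Q j] by [f].  Being prime it equals one of these, and then contains the
    variables of [D j], some power of each being in [Q j]. *)
Lemma associated_prime_component I P r (Q : 'I_r -> set {mpoly K[n]})
    (D : 'I_r -> set 'I_n) (c : 'I_r -> 'I_n -> nat) :
  (forall j i, D j i -> (0 < c j i)%N) ->
  (forall j, Q j = pure_power_gen (D j) (c j)) ->
  I = \bigcap_(j in [set: 'I_r]) Q j ->
  associated_prime I P -> exists j, P = var_ideal (D j).
Proof.
move=> cpos QE IE [primeP [f PE]]; have [idP P1 _] := primeP.
have idQ j : is_ideal (Q j) by rewrite QE; exact: ideal_gen_ideal.
have colQ j : P `<=` colon (Q j) f.
  by rewrite PE IE => g Ig; apply: Ig.
have [j jP] : exists j, colon (Q j) f `<=` P.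
  apply: prime_contains_component => // [j|g gP]; first exact: colon_is_ideal.
  by rewrite PE IE => j _; apply: gP.
have varP : var_ideal (D j) `<=` P.
  apply: ideal_gen_min => // _ [i Di <-].
  apply: (@prime_idealX _ _ _ (c j i)) => //; apply: jP.
  rewrite /colon /= mulrC; apply: idealM => //; rewrite QE.
  by apply: mem_ideal_gen; exists i.
exists j; apply/seteqP; split=> // g /colQ.
move=> /(_ j); rewrite QE; apply: pure_power_colon_sub; first exact: cpos.
  move=> Qf; apply: P1; apply: jP; rewrite /colon /= mul1r QE //.
by rewrite -QE; apply: subset_trans (colQ j).
Qed.

(** * Corner monomials *)

(** Irredundancy yields a monomial in every component but [Q j]; multiplying
    it by variables of [D] until every exponent is maximal among those
    allowed outside [Q j] does not change this. *)
Lemma corner_monomial I r (Q : 'I_r -> set {mpoly K[n]}) j D c :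
  irredundant_irreducible_decomposition I Q ->
  Q j = pure_power_gen D c ->
  exists w, (forall i, D i -> w i = (c i).-1) /\
            forall j', j' != j -> Q j' 'X_[w].
Proof.
move=> [ppQ IE irr] QE.
have monQ j' : monomial_ideal (Q j').
  by have [D' [c' [_ ->]]] := ppQ j'; exact: pure_power_gen_monomial.
have [f Qf nQf] : exists2 f, (\bigcap_(j' in [set~ j]) Q j') f & ~ Q j f.
  apply: contrapT => nof; apply: (irr j); rewrite IE.
  apply/seteqP; split=> f Qf j' _; first exact: Qf.
  have [->|/eqP nj] := eqVneq j' j; last exact: Qf.
  by apply: contrapT => nQf; apply: nof; exists f.
have [w0 w0f nQw0] : exists2 m, m \in msupp f & ~ Q j 'X_[m].
  apply: contrapT => nom; apply: nQf; apply/(monomial_idealP _ (monQ j)).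
  by move=> m mf; apply: contrapT => nQm; apply: nom; exists m.
exists [multinom if `[<D i>] then (c i).-1 else w0 i | i < n].
split=> [i Di|j' nj]; first by rewrite mnmE asboolT.
have : Q j' 'X_[w0].
  have {}nj : [set~ j] j' by apply/eqP.
  by move: w0f; apply: (monomial_idealP _ (monQ j')).1; apply: Qf.
apply: monomial_ideal_le => //; apply/mnm_lepP => i; rewrite mnmE.
case: asboolP => // Di; rewrite leqNgt; apply/negP => lt_c.
apply: nQw0; rewrite QE; apply/pure_power_genXP; exists i => //.
by case: (c i) lt_c.
Qed.

(** As [w] is not in [Q j], it represents a nonzero element of the quotient by
    [I] that is killed by every variable of [D].  This holds because [w] is
    already in the other components, and only one exponent falls short of
    [Q j]. *)
Lemma corner_socle I r (Q : 'I_r -> set {mpoly K[n]}) j D c w :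
  irredundant_irreducible_decomposition I Q ->
  Q j = pure_power_gen D c -> (forall i, D i -> (0 < c i)%N) ->
  (forall i, D i -> w i = (c i).-1) ->
  (forall j', j' != j -> Q j' 'X_[w]) ->
  forall i, D i -> I 'X_[w + U_(i)].
Proof.
move=> [ppQ IE _] QE cpos wD wQ i Di; rewrite IE => j' _.
have [->|nj] := eqVneq j' j.
  rewrite QE; apply/pure_power_genXP; exists i => //.
  by rewrite mnmDE wD // mnm1E eqxx addn1 prednK // cpos.
have [D' [c' [_ Q'E]]] := ppQ j'.
apply: (monomial_ideal_le _ _ (wQ _ nj)).
  by rewrite Q'E; exact: pure_power_gen_monomial.
by apply/mnm_lepP => t; rewrite mnmDE leq_addr.
Qed.

(** The Borel condition is applied to the corner [w]: as [w * x_i] lies in [I],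
    so does [w * x_p ^ m] for some [m].  If [p] were outside [D], no power of
    [x_p] could move [w] into [Q j]. *)
Lemma borel_component_down_closed I r (Q : 'I_r -> set {mpoly K[n]}) j D c :
  borel_type I -> irredundant_irreducible_decomposition I Q ->
  Q j = pure_power_gen D c -> (forall i, D i -> (0 < c i)%N) ->
  forall i p : 'I_n, D i -> (p <= i)%N -> D p.
Proof.
move=> [monI borelI] decI QE cpos i p Di le_pi.
have [w [wD wQ]] := corner_monomial decI QE.
have Iwi := corner_socle decI QE cpos wD wQ Di.
have idI := monomial_ideal_ideal monI.
have satw : saturation I (var_ideal [set i]) 'X_[w].
  (* One factor suffices: w times the variable i is in I. *)
  exists 1%N => //= g; rewrite mulrC.
  apply: (ideal_gen_min (I := colon I 'X_[w])); first exact: colon_is_ideal.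
  move=> _ [g1 Vg1 [g2 _ <-]]; rewrite mulrC.
  apply: idealM; first exact: colon_is_ideal.
  move: Vg1; apply: ideal_gen_min; first exact: colon_is_ideal.
  by move=> _ [_ -> <-]; rewrite /colon /= -mpolyXD addmC.
move: satw; rewrite borelI => -[k _ /(_ ('X_p ^+ k))].
have Vp : var_ideal (first_vars i.+1) ('X_p : {mpoly K[n]}).
  by apply: mem_ideal_gen; exists p.
move=> /(_ (mem_ideal_exp _ Vp)); case: decI => _ -> _ /(_ j Logic.I).
rewrite QE mpolyXn -mpolyXD => /pure_power_genXP[t Dt].
rewrite mnmDE mulmnE mnm1E; case: eqP => [-> //|_].
by rewrite mul0n addn0 wD // leqNgt prednK ?cpos // leqnn.
Qed.

Lemma down_closed_first_vars D :
  (forall i p : 'I_n, D i -> (p <= i)%N -> D p) ->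
  exists2 k, (k <= n)%N & D = first_vars k.
Proof.
move=> downD; exists (\max_(i < n | `[<D i>]) i.+1)%N.
  by apply/bigmax_leqP => i _; exact: ltn_ord.
apply/seteqP; split=> i; rewrite /first_vars /=; first move=> Di.
  apply: (@leq_bigmax_cond _ (fun i => `[<D i>]) (fun i => i.+1)).
  exact/asboolP.
apply: contraPP => nDi; apply/negP; rewrite -leqNgt.
apply/bigmax_leqP => p /asboolP Dp; rewrite ltnNge; apply/negP => le_ip.
exact/nDi/(downD _ _ Dp).
Qed.

(** With [w] the corner monomial, [w * x_i] lies in [I] and [w] does not, so a
    generator dividing the former does not divide the latter: its exponent of
    [x_i] is that of [w * x_i], namely [c i]. *)
Lemma component_exponent_in_gens I r (Q : 'I_r -> set {mpoly K[n]}) j D c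
    (A : set 'X_{1..n}) i :
  irredundant_irreducible_decomposition I Q ->
  Q j = pure_power_gen D c -> (forall i, D i -> (0 < c i)%N) ->
  I = monomial_gen A -> D i -> exists2 u, A u & u i = c i.
Proof.
move=> decI QE cpos IA Di.
have [w [wD wQ]] := corner_monomial decI QE.
have := corner_socle decI QE cpos wD wQ Di.
rewrite {1}IA => /monomial_genP/(_ (w + U_(i))%MM).
rewrite msuppX mem_head => /(_ isT)[u Au u_le]; exists u => //.
have nIw : ~ I 'X_[w].
  case: decI => _ -> _ /(_ j Logic.I); rewrite QE => /pure_power_genXP[t Dt].
  by rewrite wD // leqNgt prednK ?cpos // leqnn.
have u_le_i : (u i <= c i)%N.
  by have := mnm_lepP u_le i; rewrite mnmDE mnm1E eqxx wD // addn1 prednK ?cpos.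
apply/eqP; rewrite eqn_leq u_le_i /= leqNgt; apply/negP => lt_uc.
apply: nIw; rewrite IA; apply/monomial_genP => m; rewrite msuppX inE => /eqP ->.
exists u => //; apply/mnm_lepP => t; have := mnm_lepP u_le t.
rewrite mnmDE mnm1E; case: eqP => [<- _|_]; last by rewrite addn0.
by rewrite wD // -ltnS prednK ?cpos.
Qed.

End Monomials.

(** * The colon formula *)

Theorem proposition5p2 (K : fieldType) (n : nat) (I : set {mpoly K[n]})
    (HI : borel_type I)
    (r : nat) (Q : 'I_r -> set {mpoly K[n]})
    (HQ : irredundant_irreducible_decomposition I Q)
    (P : set {mpoly K[n]}) (HP : associated_prime I P) :
  exists k : nat,
    [/\ (k <= n)%N,
        P = var_ideal (first_vars k) &
        forall (j : 'I_r) (a : 'I_n -> nat),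
          radical (Q j) = P ->
          (forall i : 'I_n, (i < k)%N -> (0 < a i)%N) ->
          Q j = pure_power_gen (first_vars k) a ->
          forall (hk : (k < n)%N) (G : {fset 'X_{1..n}}),
            min_monomial_gens I G ->
            forall b : nat,
              (\max_(u <- G) u (Ordinal hk) <= b)%N ->
              P = colon I ((\prod_(i < n | (i < k)%N) 'X_i ^+ (a i - 1))
                           * 'X_(Ordinal hk) ^+ b)].
Proof.
have [ppQ IE _] := HQ.
have /choice[D /choice[c DcP]] := ppQ.
have cpos j i : D j i -> (0 < c j i)%N by case: (DcP j) => + _; apply.
have QE j : Q j = pure_power_gen (D j) (c j) by case: (DcP j).
have downD j := borel_component_down_closed HI HQ (QE j) (cpos j).
have [j0 PE] := associated_prime_component cpos QE IE HP.
have [k le_kn DE] := down_closed_first_vars (downD j0).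
exists k; split=> // [|j a _ apos QjE hk G [IG _] b le_b].
  by rewrite PE DE.
have monI : monomial_ideal I by case: HI.
set v : 'X_{1..n} :=
  [multinom if (i < k)%N then (a i - 1)%N
            else if i == k :> nat then b else 0%N | i < n].
have vE : (\prod_(i < n | (i < k)%N) 'X_i ^+ (a i - 1))
             * 'X_(Ordinal hk) ^+ b = 'X_[K, v].
  rewrite [RHS]mpolyXE_id [RHS](bigID (fun i : 'I_n => (i < k)%N)) /=.
  congr (_ * _); first by apply: eq_bigr => i ik; rewrite mnmE ik.
  rewrite (bigD1 (Ordinal hk)) /= ?ltnn // mnmE /= ltnn eqxx big1.
    by rewrite GRing.mulr1.
  move=> i /andP[ik]; rewrite -val_eqE /= => ne_ik.
  by rewrite mnmE (negbTE ik) (negbTE ne_ik) GRing.expr0.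
have v_lt (i : 'I_n) : (i < k)%N -> v i = (a i).-1.
  by move=> ik; rewrite mnmE ik subn1.
have [w [wD wQ]] := corner_monomial HQ QjE.
(* The corner w is in Q j', so a generator of Q j' divides w; beyond the first k
   variables w is uncontrolled, and the variable k takes over. *)
have vQ j' : j' != j -> Q j' 'X_[v].
  move=> nj; have := wQ _ nj; rewrite QE => /pure_power_genXP[t Dt ct].
  apply/pure_power_genXP; case: (ltnP t k) => [tk|kt].
    by exists t => //; rewrite v_lt // -wD.
  have Dk : D j' (Ordinal hk) by exact: (downD j' t (Ordinal hk) Dt kt).
  exists (Ordinal hk) => //; rewrite mnmE /= ltnn eqxx.
  have [u uG <-] := component_exponent_in_gens HQ (QE j') (cpos j') IG Dk.
  exact: leq_trans (leq_bigmax_seq _ uG _) le_b.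
have colonX m : I 'X_[v + m] <->
    exists2 i : 'I_n, first_vars k i & (1 <= m i)%N.
  split=> [|[i ik mi]].
    rewrite {1}IE => /(_ j Logic.I); rewrite QjE => /pure_power_genXP[i ik ai].
    exists i => //; move: ai (apos i ik); rewrite mnmDE v_lt //.
    by case: (m i) => //; rewrite addn0; case: (a i) => //= a'; rewrite ltnn.
  rewrite IE => j' _; have [->|/vQ Qv] := eqVneq j' j.
    rewrite QjE; apply/pure_power_genXP; exists i => //.
    rewrite mnmDE v_lt // -[X in (X <= _)%N](prednK (apos i ik)) -addn1.
    by rewrite leq_add2l.
  apply: monomial_ideal_le Qv.
    by rewrite QE; exact: pure_power_gen_monomial.
  by apply/mnm_lepP => t; rewrite mnmDE leq_addr.
rewrite vE PE DE; apply/seteqP; split=> f.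
  move=> /(pure_power_genP _ (fun=> 1%N)) Hf; apply/(colon_monomialP _ _ monI).
  by move=> m /Hf/colonX.
move=> /(colon_monomialP _ _ monI) Hf; apply/(pure_power_genP _ (fun=> 1%N)).
by move=> m /Hf/colonX.
Qed.
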